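(* Let $n=3$, $\eta\in\mathbb R$, and let $b=(b_1,\dots,b_6)\in\mathbb R^6$ be such that $$H_b=\tfrac12 b_1\langle \mathbf p_1,\mathbf e_3\rangle^2+\tfrac12 b_2\langle \mathbf p_2,\mathbf e_3\rangle^2+\tfrac12 b_3\Psi^2+b_4\langle \mathbf p_1,\mathbf e_3\rangle\langle \mathbf p_2,\mathbf e_3\rangle+b_5\Psi\langle \mathbf p_1,\mathbf e_3\rangle+b_6\Psi\langle \mathbf p_2,\mathbf e_3\rangle$$ ($\mathbf e_3=\mathbf e_1\times\mathbf e_2$) is positive definite in the momenta on $T^*V_{3,2}$, with associated $SO(3)$-invariant Riemannian metric $ds^2_b$ on $V_{3,2}$. Then, under the identification $V_{3,2}\cong SO(3)$, the magnetic geodesic flow of $ds_b^2$ (the Hamiltonian flow of $H_b$ on $(T^*V_{3,2},\omega_\eta)$) represents the inertial motion (no potential forces) of a system rigid body + gyrostat around a fixed point, where the inertia operator is $$I_b=A_b^{-1},\qquad A_b=\begin{pmatrix} b_2 & -b_4 & -b_6\\ -b_4 & b_1 & b_5\\ -b_6 & b_5 & b_3\end{pmatrix},$$ and the gyrostat momentum is $\mathbf L=(0,0,-\eta)$.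
   Context: **Phase space.** $V_{3,2}=\{(\mathbf e_1,\mathbf e_2)\in\mathbb R^{3}\times\mathbb R^3 : |\mathbf e_1|=|\mathbf e_2|=1,\ \langle \mathbf e_1,\mathbf e_2\rangle=0\}$. $T^*V_{3,2}$ is realized as the set of $(\mathbf e_1,\mathbf e_2,\mathbf p_1,\mathbf p_2)\in\mathbb R^{12}$ with $(\mathbf e_1,\mathbf e_2)\in V_{3,2}$, $\langle \mathbf e_1,\mathbf p_1\rangle=\langle \mathbf e_2,\mathbf p_2\rangle=0$, $\langle \mathbf e_1,\mathbf p_2\rangle+\langle \mathbf e_2,\mathbf p_1\rangle=0$. The twisted symplectic form $\omega_\eta$ is the restriction to $T^*V_{3,2}$ of $\sum_i(dp_1^i\wedge de_1^i+dp_2^i\wedge de_2^i)+\eta\sum_i de_1^i\wedge de_2^i$, with the sign convention that in the ambient space the Hamiltonian equations are $\dot{\mathbf e}_i=\partial H/\partial\mathbf p_i$, $\dot{\mathbf p}_1=-\partial H/\partial\mathbf e_1+\eta\,\partial H/\partial\mathbf p_2$, $\dot{\mathbf p}_2=-\partial H/\partial\mathbf e_2-\eta\,\partial H/\partial\mathbf p_1$. $\Psi=\langle \mathbf e_1,\mathbf p_2\rangle-\langle \mathbf e_2,\mathbf p_1\rangle$. **Identification with $SO(3)$.** $(\mathbf e_1,\mathbf e_2)\mapsto R=(\mathbf e_1\ \mathbf e_2\ \mathbf e_3)\in SO(3)$; $R$ maps the frame attached to the body to the fixed frame. For $v\in\mathbb R^3$ let $\hat v$ be the skew matrix with $\hat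 v w=v\times w$. With $x\wedge y=xy^T-yx^T$ and $\Phi_0=\mathbf p_1\wedge\mathbf e_1+\mathbf p_2\wedge\mathbf e_2$, the body momentum $\mathbf M=(M_1,M_2,M_3)$ is defined by $\hat{\mathbf M}=R^T\Phi_0R$, i.e. $M_1=\langle\mathbf p_2,\mathbf e_3\rangle$, $M_2=-\langle \mathbf p_1,\mathbf e_3\rangle$, $M_3=\langle\mathbf p_1,\mathbf e_2\rangle-\langle\mathbf p_2,\mathbf e_1\rangle=-\Psi$. **Rigid body with a gyrostat.** For inertia operator $I$ and constant (in the body frame) gyrostat momentum $\mathbf L\in\mathbb R^3$, the inertial motion around a fixed point is governed by $$\frac{d}{dt}(\mathbf M+\mathbf L)=(\mathbf M+\mathbf L)\times\Omega,\qquad \Omega=I^{-1}\mathbf M,$$ where $\Omega$ is the angular velocity in the body frame, $\dot R=R\hat\Omega$. ''Represents'' means that, under the correspondence $(\mathbf e_1,\mathbf e_2,\mathbf p_1,\mathbf p_2)\leftrightarrow(R,\mathbf M)$ given by $R=(\mathbf e_1\ \mathbf e_2\ \mathbf e_3)$ and $\hat{\mathbf M}=R^T\Phi_0R$, the Hamiltonian flow is given by the equations $\frac{d}{dt}(\mathbf M+\mathbf L)=(\mathbf M+\mathbf L)\times\Omega$, $\Omega=I^{-1}\mathbf M$, $\dot R=R\hat\Omega$. *)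

(* Defs.v *)
From HB Require Import structures.
From mathcomp Require Import all_boot all_order all_algebra.
From mathcomp Require Import all_classical all_reals all_analysis.
From mathcomp Require Import ring.
Set Implicit Arguments.
Unset Strict Implicit.
Unset Printing Implicit Defensive.
Import Order.TTheory GRing.Theory Num.Theory.
Import numFieldNormedType.Exports.
Local Open Scope classical_set_scope.
Local Open Scope ring_scope.

Definition vec3 {R : realType} (x y z : R) : 'cV[R]_3 :=
  \col_i [:: x; y; z]`_i.

Definition mx3 {R : realType} (rows : seq (seq R)) : 'M[R]_3 :=
  \matrix_(i, j) (nth [::] rows i)`_j.

(* The norm [`| u |] of the library is the sup norm; the Euclidean length of
   [u] is the square root of [dot u u]. *)
Definition dot {R : realType} (u v : 'cV[R]_3) : R := \sum_i u i 0 * v i 0.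

Definition cross {R : realType} (u v : 'cV[R]_3) : 'cV[R]_3 :=
  vec3 (u 1 0 * v 2 0 - u 2 0 * v 1 0)
       (u 2 0 * v 0 0 - u 0 0 * v 2 0)
       (u 0 0 * v 1 0 - u 1 0 * v 0 0).

Definition hat {R : realType} (v : 'cV[R]_3) : 'M[R]_3 :=
  mx3 [:: [:: 0; - v 2 0; v 1 0];
          [:: v 2 0; 0; - v 0 0];
          [:: - v 1 0; v 0 0; 0]].

(* The inverse of [hat] on skew-symmetric matrices. *)
Definition vee {R : realType} (S : 'M[R]_3) : 'cV[R]_3 :=
  vec3 (S 2 1) (S 0 2) (S 1 0).

Definition wedge {R : realType} (x y : 'cV[R]_3) : 'M[R]_3 :=
  x *m y^T - y *m x^T.

Definition SO3 {R : realType} : set 'M[R]_3 :=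
  [set Q | Q^T *m Q = 1%:M /\ \det Q = 1].

(* All iterated directional derivatives exist and are differentiable; for a
   finite-dimensional [V] this is C^oo. *)
Definition smooth {R : realType} {V : normedModType R} (f : V -> R) : Prop :=
  forall (vs : seq V) (x : V),
    differentiable (foldr (fun v h => 'D_v h : V -> R) f vs) x.

Definition level0 {R : realType} {V : normedModType R} {k : nat}
    (c : 'I_k -> V -> R) : set V :=
  [set x | forall i, c i x = 0].

(* The tangent space at [x] of the submanifold [level0 c], for a family [c] of
   constraints with linearly independent differentials. *)
Definition tangent0 {R : realType} {V : normedModType R} {k : nat}
    (c : 'I_k -> V -> R) (x : V) : set V :=
  [set v | forall i, 'D_v (c i) x = 0].

Notation pair3 R := ('cV[R]_3 * 'cV[R]_3)%type.

(* A point ((e1, e2), (p1, p2)) of R^12; a tangent vector to R^12 is written in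
   the same order. *)
Notation phase R := (pair3 R * pair3 R)%type.

Definition stiefel_eqs {R : realType} (i : 'I_3) (e : pair3 R) : R :=
  [:: dot e.1 e.1 - 1; dot e.2 e.2 - 1; dot e.1 e.2]`_i.

Definition stiefel {R : realType} : set (pair3 R) := level0 stiefel_eqs.

Definition tangent_stiefel {R : realType} (e : pair3 R) : set (pair3 R) :=
  tangent0 stiefel_eqs e.

Definition cotangent_eqs {R : realType} (i : 'I_6) (z : phase R) : R :=
  let e1 := z.1.1 in let e2 := z.1.2 in let p1 := z.2.1 in let p2 := z.2.2 in
  [:: dot e1 e1 - 1; dot e2 e2 - 1; dot e1 e2;
      dot e1 p1; dot e2 p2; dot e1 p2 + dot e2 p1]`_i.

Definition cotangent_stiefel {R : realType} : set (phase R) :=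
  level0 cotangent_eqs.

Definition tangent_cotangent {R : realType} (z : phase R) : set (phase R) :=
  tangent0 cotangent_eqs z.

(* The pairing of a covector p at e with a tangent vector v at e. *)
Definition pairing {R : realType} (p v : pair3 R) : R :=
  dot p.1 v.1 + dot p.2 v.2.

(* The constant ambient 2-form, with (dp /\ de)(X, Y) = dp X de Y - dp Y de X. *)
Definition omega {R : realType} (eta : R) (X Y : phase R) : R :=
  pairing X.2 Y.1 - pairing Y.2 X.1
  + eta * (dot X.1.1 Y.1.2 - dot Y.1.1 X.1.2).

(* [X] is the value at [z] of the Hamiltonian vector field of [H] on the
   twisted cotangent bundle, i.e. i_X omega = - dH on tangent vectors.  On all
   of R^12 this sign gives e_i' = dH/dp_i, p_1' = - dH/de_1 + eta dH/dp_2 and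
   p_2' = - dH/de_2 - eta dH/dp_1. *)
Definition hamiltonian_vector {R : realType} (eta : R) (H : phase R -> R)
    (z X : phase R) : Prop :=
  tangent_cotangent z X /\
  forall Y, tangent_cotangent z Y -> omega eta X Y = - 'D_Y H z.

Definition hamiltonian_curve {R : realType} (eta : R) (H : phase R -> R)
    (J : set R) (gamma : R -> phase R) : Prop :=
  forall t, J t ->
    derivable gamma t 1 /\ hamiltonian_vector eta H (gamma t) ('D_1 gamma t).

Definition Psi {R : realType} (z : phase R) : R :=
  dot z.1.1 z.2.2 - dot z.1.2 z.2.1.

Definition Hb {R : realType} (b1 b2 b3 b4 b5 b6 : R) (z : phase R) : R :=
  let e1 := z.1.1 in let e2 := z.1.2 in let p1 := z.2.1 in let p2 := z.2.2 in
  let e3 := cross e1 e2 in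
  2^-1 * b1 * dot p1 e3 ^+ 2 + 2^-1 * b2 * dot p2 e3 ^+ 2
  + 2^-1 * b3 * Psi z ^+ 2
  + b4 * (dot p1 e3 * dot p2 e3)
  + b5 * (Psi z * dot p1 e3) + b6 * (Psi z * dot p2 e3).

Definition momenta_posdef {R : realType} (H : phase R -> R) : Prop :=
  forall z, cotangent_stiefel z -> z.2 != 0 -> 0 < H z.

(* A Riemannian metric on V_{3,2}, as the restriction of a smooth field of
   symmetric bilinear forms on R^6; every metric on this closed submanifold
   arises in this way. *)
Definition riemannian_metric {R : realType}
    (g : pair3 R -> pair3 R -> pair3 R -> R) : Prop :=
  [/\ forall v w, smooth (fun e => g e v w),
      forall e a u v w, g e (a *: u + v) w = a * g e u w + g e v w,
      forall e v w, g e v w = g e w v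
    & forall e v, stiefel e -> tangent_stiefel e v -> v != 0 -> 0 < g e v v].

Definition rotate {R : realType} (Q : 'M[R]_3) (v : pair3 R) : pair3 R :=
  (Q *m v.1, Q *m v.2).

Definition SO3_invariant {R : realType}
    (g : pair3 R -> pair3 R -> pair3 R -> R) : Prop :=
  forall Q e v w, SO3 Q -> stiefel e ->
    tangent_stiefel e v -> tangent_stiefel e w ->
    g (rotate Q e) (rotate Q v) (rotate Q w) = g e v w.

(* [H] is the kinetic energy of [g] in the momenta: if v is the tangent vector
   g-dual to the covector p, then H(e, p) = g_e(v, v) / 2. *)
Definition kinetic_hamiltonian {R : realType}
    (g : pair3 R -> pair3 R -> pair3 R -> R) (H : phase R -> R) : Prop :=
  forall e p v, cotangent_stiefel (e, p) -> tangent_stiefel e v ->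
    (forall w, tangent_stiefel e w -> pairing p w = g e v w) ->
    H (e, p) = 2^-1 * g e v v.

Definition frame {R : realType} (e : pair3 R) : 'M[R]_3 :=
  \matrix_(i, j) ([:: e.1; e.2; cross e.1 e.2]`_j) i 0.

Definition Phi0 {R : realType} (z : phase R) : 'M[R]_3 :=
  wedge z.2.1 z.1.1 + wedge z.2.2 z.1.2.

Definition body_momentum {R : realType} (z : phase R) : 'cV[R]_3 :=
  vee ((frame z.1)^T *m Phi0 z *m frame z.1).

Definition to_body {R : realType} (z : phase R) : 'M[R]_3 * 'cV[R]_3 :=
  (frame z.1, body_momentum z).

Definition inertia_operator {R : realType} (I : 'M[R]_3) : Prop :=
  I^T = I /\ forall x : 'cV[R]_3, x != 0 -> 0 < dot x (I *m x).

Definition gyrostat_motion {R : realType} (I : 'M[R]_3) (L : 'cV[R]_3)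
    (J : set R) (Q : R -> 'M[R]_3) (M : R -> 'cV[R]_3) : Prop :=
  forall t, J t ->
    let Omega := invmx I *m M t in
    is_derive t (1 : R) (fun s => M s + L) (cross (M t + L) Omega) /\
    is_derive t (1 : R) Q (Q t *m hat Omega).

(* The flow of [H] represents the inertial motion of the gyrostat: [to_body]
   identifies the phase space with SO(3) x R^3, and it matches the integral
   curves (over arbitrary open time intervals) with the gyrostat motions. *)
Definition represents_gyrostat {R : realType} (eta : R) (H : phase R -> R)
    (I : 'M[R]_3) (L : 'cV[R]_3) : Prop :=
  [/\ inertia_operator I,
      set_bij cotangent_stiefel (SO3 `*` [set: 'cV[R]_3]) to_body
    & forall (J : set R) (gamma : R -> phase R),
        open J -> is_interval J ->
        (forall t, J t -> cotangent_stiefel (gamma t)) ->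
        hamiltonian_curve eta H J gamma <->
        gyrostat_motion I L J (fun t => frame (gamma t).1)
                              (fun t => body_momentum (gamma t))].

Definition Ab {R : realType} (b1 b2 b3 b4 b5 b6 : R) : 'M[R]_3 :=
  mx3 [:: [:: b2; - b4; - b6];
          [:: - b4; b1; b5];
          [:: - b6; b5; b3]].

Lemma hatE {R : realType} (v w : 'cV[R]_3) : hat v *m w = cross v w.
Proof.
have e1 : lift ord0 ord0 = 1 :> 'I_3 by apply/val_inj.
have e2 : lift ord0 (lift ord0 ord0) = 2 :> 'I_3 by apply/val_inj.
apply/matrixP => i j; rewrite (ord1 j) mxE !big_ord_recl big_ord0 !mxE.
case: i => [[|[|[|//]]] ?] /=; rewrite ?e1 ?e2; ring.
Qed.

Lemma hat_body_momentum {R : realType} (z : phase R) :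
  hat (body_momentum z) = (frame z.1)^T *m Phi0 z *m frame z.1.
Proof.
have skew_wedge (x y : 'cV[R]_3) : (wedge x y)^T = - wedge x y.
  by rewrite /wedge raddfB /= !trmx_mul !trmxK opprB.
rewrite /body_momentum; set S := _ *m _ *m _.
have skewS : S^T = - S.
  have skewP : (Phi0 z)^T = - Phi0 z.
    by rewrite /Phi0 linearD /= !skew_wedge [RHS]opprD.
  by rewrite /S !trmx_mul trmxK skewP mulmxA mulmxN mulNmx.
have skew i j : S i j = - S j i.
  by have /matrixP/(_ j i) := skewS; rewrite !mxE.
have diag i : S i i = 0.
  by have := skew i i; move=> /eqP; rewrite -addr_eq0 -mulr2n mulrn_eq0 => /eqP.
clearbody S; apply/matrixP => i j; rewrite !mxE.
have ord3P (k : 'I_3) : [\/ k = 0, k = 1 | k = 2].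
  by case: k => [[|[|[|//]]] ?]; [constructor 1|constructor 2|constructor 3];
     apply/val_inj.
case: (ord3P i) => ->; case: (ord3P j) => -> /=; rewrite ?diag -?skew //.
Qed.

(* Main.v *)
(* Left-trivialise T*V_{3,2} = T*SO(3): a tangent vector X at (R, M) has body
   coordinates (w, m), where R' = R w^ and M' = m.  In these coordinates
     omega_eta((w, m), (w', m')) = m.w' - m'.w - ((M + L) x w).w',
   with L = (0, 0, -eta), and H_b = M.(A_b M) / 2, so dH(w', m') = (A_b M).m'.
   As (w', m') is arbitrary, i_X omega = -dH says exactly that w = A_b M and
   m = (M + L) x w.  The metric is g_e(v, v') = w.(A_b^-1 w'), with w and w' the
   body angular velocities of v and v'. *)
Require Import Defs.
From mathcomp Require Import all_boot all_order all_algebra.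
From mathcomp Require Import all_classical all_reals all_analysis.
From mathcomp Require Import ring lra.
Set Implicit Arguments.
Unset Strict Implicit.
Unset Printing Implicit Defensive.
Import Order.TTheory GRing.Theory Num.Theory.
Import numFieldNormedType.Exports.
Local Open Scope classical_set_scope.
Local Open Scope ring_scope.

(** The value of [L] comes from the magnetic term. At the identity frame, an angular velocity w
    gives e1' = (0, w3, -w2) and e2' = (-w3, 0, w1), so eta de1 /\ de2 takes the value eta e3.(w x
    w') = -(L x w).w', which merges with the term -(M x w).w' of the canonical form. Two obstacles
    shape the proof. Everything is stated in the redundant coordinates of R^12; rotation invariance
    moves the identities to the identity frame, where the constraints can be solved. And the
    correspondence concerns curves: a gyrostat motion supplies derivatives of R and M only, so the
    differentiability of the phase curve has to be recovered from them, and [body_momentum] may be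
    exchanged for the polynomial [mom] only on the constraint set, hence on a neighbourhood of t
    inside the open set J. *)

(** * Directional derivatives of pairs, matrices and products *)

Section Derivatives.
Variables (R : realType) (V : normedModType R).
Implicit Types (x v : V).

Lemma is_derive_mxP m n (f : V -> 'M[R]_(m, n)) df x v :
  is_derive x v f df <->
  forall i j, is_derive x v (fun y => f y i j) (df i j).
Proof.
split=> [[fx <-] i j|fij].
  split; first exact: (derivable_mxP _ _ _).1.
  by rewrite derive_mx // mxE.
have fx : derivable f x v by apply/derivable_mxP => i j; have [] := fij i j.
split=> //; rewrite derive_mx //; apply/matrixP => i j; rewrite mxE.
by have [] := fij i j.
Qed.

(** A directional derivative alone gives no general chain rule, but a linear map commutes with
    difference quotients and a continuous one with their limit. *)
Lemma is_derive_comp_linear (W W' : normedModType R) (l : {linear W -> W'})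
    (f : V -> W) df x v :
  continuous l -> is_derive x v f df -> is_derive x v (l \o f) (l df).
Proof.
move=> lc [fx <-].
have lim_l : h^-1 *: ((l \o f) (h *: v + x) - (l \o f) x) @[h --> 0^']
    --> l ('D_v f x).
  rewrite [X in X @ _](_ : _ =
      l \o (fun h => h^-1 *: (f (h *: v + x) - f x))); last first.
    by apply/funext => h /=; rewrite -linearB -[LHS]linearZ_LR.
  by apply: continuous_cvg; [exact: lc|exact: fx].
by split; [apply/cvg_ex; exists (l ('D_v f x)) | apply/cvg_lim].
Qed.

Lemma is_derive_pair (W W' : normedModType R) (f : V -> W) (g : V -> W')
    df dg x v :
  is_derive x v f df -> is_derive x v g dg ->
  is_derive x v (fun y => (f y, g y)) (df, dg).
Proof.
move=> [fx <-] [gx <-].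
have lim_fg : h^-1 *: ((f (h *: v + x), g (h *: v + x)) - (f x, g x))
    @[h --> 0^'] --> ('D_v f x, 'D_v g x) by exact: (cvg_pair fx gx).
split; first by apply/cvg_ex; exists ('D_v f x, 'D_v g x).
by apply/cvg_lim.
Qed.

Lemma is_derive_fst (W W' : normedModType R) (f : V -> W * W') df x v :
  is_derive x v f df -> is_derive x v (fun y => (f y).1) df.1.
Proof.
move=> fx.
apply: (@is_derive_comp_linear (W * W')%type W fst _ _ _ _ _ fx) => y.
exact: cvg_fst.
Qed.

Lemma is_derive_snd (W W' : normedModType R) (f : V -> W * W') df x v :
  is_derive x v f df -> is_derive x v (fun y => (f y).2) df.2.
Proof.
move=> fx.
apply: (@is_derive_comp_linear (W * W')%type W' snd _ _ _ _ _ fx) => y.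
exact: cvg_snd.
Qed.

Lemma is_derive_mul (f g : V -> R) df dg x v :
  is_derive x v f df -> is_derive x v g dg ->
  is_derive x v (fun y => f y * g y) (df * g x + f x * dg).
Proof.
move=> fx gx; apply: (is_derive_eq (is_deriveM fx gx)).
by rewrite /= addrC [g x *: _]mulrC.
Qed.

End Derivatives.

(** * Coordinate computations in R^3 and the action of rotations *)

Section Coordinates.
Variable R : realType.
Implicit Types (u v w : 'cV[R]_3) (Q : 'M[R]_3).

Lemma ord3P (k : 'I_3) : [\/ k = 0, k = 1 | k = 2].
Proof.
by case: k => [[|[|[|//]]] ?]; [constructor 1|constructor 2|constructor 3];
   apply/val_inj.
Qed.

Lemma sum3 (F : 'I_3 -> R) : \sum_i F i = F 0 + F 1 + F 2.
Proof.
rewrite !big_ord_recr big_ord0 /= add0r.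
by congr (F _ + F _ + F _); apply/val_inj.
Qed.

Lemma vec3E x y z :
  (vec3 x y z 0 0 = x :> R) * (vec3 x y z 1 0 = y :> R)
  * (vec3 x y z 2 0 = z :> R).
Proof. by rewrite !mxE. Qed.

Lemma cV3P u v :
  u 0 0 = v 0 0 -> u 1 0 = v 1 0 -> u 2 0 = v 2 0 -> u = v.
Proof.
move=> h0 h1 h2; apply/colP => i.
by case: (ord3P i) => ->.
Qed.

Lemma dotE u v : dot u v = u 0 0 * v 0 0 + u 1 0 * v 1 0 + u 2 0 * v 2 0.
Proof. exact: sum3. Qed.

Lemma mulmxvE Q v i :
  (Q *m v) i 0 = Q i 0 * v 0 0 + Q i 1 * v 1 0 + Q i 2 * v 2 0.
Proof. by rewrite mxE sum3. Qed.

Lemma crossE u v :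
  (cross u v 0 0 = u 1 0 * v 2 0 - u 2 0 * v 1 0)
  * (cross u v 1 0 = u 2 0 * v 0 0 - u 0 0 * v 2 0)
  * (cross u v 2 0 = u 0 0 * v 1 0 - u 1 0 * v 0 0).
Proof. by rewrite /cross !vec3E. Qed.

Lemma colDE u v i j : (u + v) i j = u i j + v i j.
Proof. by rewrite mxE. Qed.

Lemma colNE u i j : (- u) i j = - u i j.
Proof. by rewrite mxE. Qed.

Lemma colZE (a : R) u i j : (a *: u) i j = a * u i j.
Proof. by rewrite mxE. Qed.

Definition coordE := (dotE, crossE, vec3E, colDE, colNE, colZE).

Lemma dot_trmx Q u v : dot (Q *m u) v = dot u (Q^T *m v).
Proof. by rewrite !dotE !mulmxvE !mxE; ring. Qed.

Lemma dot_sym u v : dot u v = dot v u.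
Proof. by rewrite !dotE; ring. Qed.

Lemma dot_inj u v : (forall w, dot u w = dot v w) -> u = v.
Proof.
move=> uv; have := uv (vec3 1 0 0); have := uv (vec3 0 1 0).
have := uv (vec3 0 0 1); rewrite !coordE !(mulr0, mulr1, addr0, add0r).
by move=> h2 h1 h0; apply: cV3P.
Qed.

Lemma det3E Q : \det Q =
  Q 0 0 * (Q 1 1 * Q 2 2 - Q 2 1 * Q 1 2)
  + Q 1 0 * (Q 2 1 * Q 0 2 - Q 0 1 * Q 2 2)
  + Q 2 0 * (Q 0 1 * Q 1 2 - Q 1 1 * Q 0 2).
Proof.
(* Entries are reindexed by naturals, so that ordinals of equal value produced by the two nested
   expansions become the same term for [ring]. *)
pose q i j := Q (inord i) (inord j).
have qE i j : Q i j = q i j by rewrite /q !inord_val.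
rewrite (expand_det_col _ 0) sum3 /cofactor.
rewrite !(expand_det_row _ 0) !big_ord_recr !big_ord0 /= /cofactor.
rewrite !det_mx11 !mxE !qE /= /bump /=.
have n1 : (1 %% 3 = 1)%N by [].
have n2 : ((1 + 1) %% 3 = 2)%N by [].
have n3 : (1 + 1 = 2)%N by [].
rewrite !n1 !n2 !addn0 !add0n !n3; ring.
Qed.

Lemma SO3_mulV Q : SO3 Q -> Q^T *m Q = 1%:M.
Proof. by case. Qed.

Lemma SO3_Vmul Q : SO3 Q -> Q *m Q^T = 1%:M.
Proof. by case=> /mulmx1C. Qed.

Lemma dot_SO3 Q u v : SO3 Q -> dot (Q *m u) (Q *m v) = dot u v.
Proof. by move=> /SO3_mulV QQ; rewrite dot_trmx mulmxA QQ mul1mx. Qed.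

Lemma dot_mul_cross Q u v w :
  dot (Q *m u) (cross (Q *m v) (Q *m w)) = \det Q * dot u (cross v w).
Proof. by rewrite det3E !coordE !mulmxvE; ring. Qed.

(** The triple product scales by [\det Q], which is 1 here; pairing with an arbitrary vector,
    written as an image under [Q], then identifies the two sides. *)
Lemma cross_SO3 Q v w :
  SO3 Q -> cross (Q *m v) (Q *m w) = Q *m cross v w.
Proof.
move=> SQ; apply: dot_inj => u.
have -> : u = Q *m (Q^T *m u) by rewrite mulmxA SO3_Vmul // mul1mx.
by rewrite dot_SO3 // [LHS]dot_sym dot_mul_cross SQ.2 mul1r dot_sym.
Qed.

Lemma hat_inj : injective (@hat R).
Proof.
move=> u v uv; apply: cV3P.
- by have /matrixP/(_ 2 1) := uv; rewrite !mxE.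
- by have /matrixP/(_ 0 2) := uv; rewrite !mxE.
- by have /matrixP/(_ 1 0) := uv; rewrite !mxE.
Qed.

End Coordinates.

(** * Body coordinates on the phase space and the twisted form in them *)

Section Stiefel.
Variable R : realType.
Implicit Types (u w x y : 'cV[R]_3) (Q : 'M[R]_3) (e p v : pair3 R).
Implicit Types (z X Y : phase R).

(** The base point with identity frame. Each [e] is its image under [frame e], so an equivariant
    identity need only be checked here. *)
Definition std : pair3 R := (vec3 1 0 0, vec3 0 1 0).

Definition orthonormal2 e :=
  [/\ dot e.1 e.1 = 1, dot e.2 e.2 = 1 & dot e.1 e.2 = 0].

Lemma stiefelP e : stiefel e <-> orthonormal2 e.
Proof.
split=> [h|[h1 h2 h3] i].
  split; last exact: (h 2).
  - by have := h 0; rewrite /stiefel_eqs /= => /subr0_eq.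
  - by have := h 1; rewrite /stiefel_eqs /= => /subr0_eq.
by rewrite /stiefel_eqs; case: (ord3P i) => -> /=; rewrite ?h1 ?h2 ?h3 ?subrr.
Qed.

(** The same equations cut out tangent vectors and covectors, so [rigid] and [angvel] apply to
    momenta as well. *)
Definition tangent_eqs e v :=
  [/\ dot e.1 v.1 = 0, dot e.2 v.2 = 0 & dot e.1 v.2 + dot e.2 v.1 = 0].

Lemma cotangentP z :
  cotangent_stiefel z <-> stiefel z.1 /\ tangent_eqs z.1 z.2.
Proof.
rewrite stiefelP; split=> [h|[[h1 h2 h3] [h4 h5 h6]] i].
  split; first split.
  - by have := h 0; rewrite /cotangent_eqs /= => /subr0_eq.
  - by have := h (inord 1); rewrite /cotangent_eqs inordK //= => /subr0_eq.
  - by have := h (inord 2); rewrite /cotangent_eqs inordK.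
  split.
  - by have := h (inord 3); rewrite /cotangent_eqs inordK.
  - by have := h (inord 4); rewrite /cotangent_eqs inordK.
  - by have := h (inord 5); rewrite /cotangent_eqs inordK.
rewrite /cotangent_eqs; case: i => [[|[|[|[|[|[|//]]]]]] ?] /=;
  by rewrite ?h1 ?h2 ?h3 ?subrr.
Qed.

Lemma frame_col e :
  (frame e *m vec3 1 0 0 = e.1) * (frame e *m vec3 0 1 0 = e.2)
  * (frame e *m vec3 0 0 1 = cross e.1 e.2).
Proof. by do !split; apply: cV3P; rewrite mulmxvE !coordE !mxE /= ; ring. Qed.

Lemma rotate_std e : rotate (frame e) std = e.
Proof. by case: e => x y; rewrite /rotate !frame_col. Qed.

Lemma dot_cross_l u w : dot u (cross u w) = 0.
Proof. by rewrite !coordE; ring. Qed.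

Lemma dot_cross_r u w : dot w (cross u w) = 0.
Proof. by rewrite !coordE; ring. Qed.

Lemma dot_cross_cross u w :
  dot (cross u w) (cross u w) = dot u u * dot w w - dot u w ^+ 2.
Proof. by rewrite !coordE; ring. Qed.

Lemma frame_SO3 e : stiefel e -> SO3 (frame e).
Proof.
move=> /stiefelP[e11 e22 e12].
have e33 : dot (cross e.1 e.2) (cross e.1 e.2) = 1.
  by rewrite dot_cross_cross e11 e22 e12; ring.
split; last first.
  (* The determinant of the frame is the squared length of its third column. *)
  by rewrite det3E -[RHS]e33 !coordE !mxE /=; ring.
apply/matrixP => i j; rewrite !mxE.
under eq_bigr do rewrite !mxE.
set c := [:: e.1; e.2; cross e.1 e.2]; rewrite -[LHS]/(dot c`_i c`_j) {}/c.
by case: (ord3P i) => ->; case: (ord3P j) => -> /=;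
  rewrite ?e11 ?e22 ?e12 ?e33 ?(dot_sym e.2 e.1) ?e12 ?dot_cross_l
    ?dot_cross_r // dot_sym ?dot_cross_l ?dot_cross_r.
Qed.

Lemma stiefel_rotate Q e : SO3 Q -> stiefel e -> stiefel (rotate Q e).
Proof.
move=> SQ /stiefelP[e11 e22 e12]; apply/stiefelP.
by rewrite /orthonormal2 /= !dot_SO3.
Qed.

Lemma stiefel_std : stiefel std.
Proof. by apply/stiefelP; split; rewrite !coordE /=; ring. Qed.

Lemma frame_rotate_std Q : SO3 Q -> frame (rotate Q std) = Q.
Proof.
move=> SQ; apply/matrixP => i j; rewrite mxE /= cross_SO3 //.
have -> : cross (vec3 1 0 0) (vec3 0 1 0) = vec3 0 0 1 :> 'cV[R]_3.
  by apply: cV3P; rewrite !coordE; ring.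
by case: (ord3P j) => -> /=; rewrite mulmxvE !vec3E; ring.
Qed.

Lemma rotateK Q : SO3 Q -> cancel (rotate Q^T) (rotate Q).
Proof. by move=> SQ [x y]; rewrite /rotate /= !mulmxA SO3_Vmul // !mul1mx. Qed.

(* The velocity of [e] under [R' = R w^], for [R = frame e]; [angvel e] is the
   inverse of [rigid e] on tangent vectors. *)
Definition rigid e w : pair3 R :=
  (w 2 0 *: e.2 - w 1 0 *: cross e.1 e.2,
   w 0 0 *: cross e.1 e.2 - w 2 0 *: e.1).

Definition angvel e v : 'cV[R]_3 :=
  vec3 (dot v.2 (cross e.1 e.2)) (- dot v.1 (cross e.1 e.2))
       (2^-1 * (dot v.1 e.2 - dot v.2 e.1)).

(* Agrees with [body_momentum] only where [e] is orthonormal, and has a simpler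
   derivative; [dmom z X] is its derivative at [z] along [X]. *)
Definition mom e p : 'cV[R]_3 :=
  vec3 (dot p.2 (cross e.1 e.2)) (- dot p.1 (cross e.1 e.2))
       (dot p.1 e.2 - dot p.2 e.1).

Definition dmom z X : 'cV[R]_3 :=
  let de3 := cross X.1.1 z.1.2 + cross z.1.1 X.1.2 in
  vec3 (dot X.2.2 (cross z.1.1 z.1.2) + dot z.2.2 de3)
       (- (dot X.2.1 (cross z.1.1 z.1.2) + dot z.2.1 de3))
       (dot X.2.1 z.1.2 + dot z.2.1 X.1.2
        - (dot X.2.2 z.1.1 + dot z.2.2 X.1.1)).

(** [mom e] is the transpose of [rigid e]: this makes it the momentum conjugate to the body angular
    velocity. *)
Lemma pairing_rigid e p w : pairing p (rigid e w) = dot (mom e p) w.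
Proof. rewrite /pairing /= !coordE. ring. Qed.

Lemma rigid_rotate Q e w : SO3 Q -> rigid (rotate Q e) w = rotate Q (rigid e w).
Proof.
by move=> SQ; rewrite /rigid /rotate /= cross_SO3 // !linearB /= !linearZ.
Qed.

Lemma angvel_rotate Q e v :
  SO3 Q -> angvel (rotate Q e) (rotate Q v) = angvel e v.
Proof. by move=> SQ; rewrite /angvel /= cross_SO3 // !dot_SO3. Qed.

Lemma mom_rotate Q e v : SO3 Q -> mom (rotate Q e) (rotate Q v) = mom e v.
Proof. by move=> SQ; rewrite /mom /= cross_SO3 // !dot_SO3. Qed.

Definition rotate2 Q z : phase R := (rotate Q z.1, rotate Q z.2).

Lemma dmom_rotate Q z X : SO3 Q -> dmom (rotate2 Q z) (rotate2 Q X) = dmom z X.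
Proof. by move=> SQ; rewrite /dmom /= !cross_SO3 // -!mulmxDr !dot_SO3. Qed.

Lemma omega_rotate Q eta X Y :
  SO3 Q -> omega eta (rotate2 Q X) (rotate2 Q Y) = omega eta X Y.
Proof. by move=> SQ; rewrite /omega /pairing /= !dot_SO3. Qed.

Definition tangent2_eqs z X :=
  tangent_eqs z.1 X.1 /\
  [/\ dot X.1.1 z.2.1 + dot z.1.1 X.2.1 = 0,
      dot X.1.2 z.2.2 + dot z.1.2 X.2.2 = 0
    & dot X.1.1 z.2.2 + dot z.1.1 X.2.2 + (dot X.1.2 z.2.1 + dot z.1.2 X.2.1)
      = 0].

Lemma tangent_rotate Q e v :
  SO3 Q -> tangent_eqs (rotate Q e) (rotate Q v) <-> tangent_eqs e v.
Proof. by move=> SQ; rewrite /tangent_eqs /= !dot_SO3. Qed.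

Lemma tangent2_rotate Q z X :
  SO3 Q -> tangent2_eqs (rotate2 Q z) (rotate2 Q X) <-> tangent2_eqs z X.
Proof.
by move=> SQ; rewrite /tangent2_eqs tangent_rotate //= !dot_SO3.
Qed.

Lemma tangent_rigid e w : stiefel e -> tangent_eqs e (rigid e w).
Proof.
move=> se; have SQ := frame_SO3 se; rewrite -(rotate_std e) rigid_rotate //.
by apply/tangent_rotate => //; split; rewrite /= !coordE; ring.
Qed.

Lemma angvel_rigid e w : stiefel e -> angvel e (rigid e w) = w.
Proof.
move=> se; have SQ := frame_SO3 se.
rewrite -(rotate_std e) rigid_rotate // angvel_rotate //.
by apply: cV3P; rewrite !coordE /= ; field.
Qed.

Lemma rigid_angvel e v :
  stiefel e -> tangent_eqs e v -> rigid e (angvel e v) = v.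
Proof.
move=> se; have SQ := frame_SO3 se.
rewrite -(rotate_std e) -(rotateK SQ v); move: (rotate _ v) => {}v.
rewrite tangent_rotate // angvel_rotate // rigid_rotate // => tv; congr rotate.
case: v tv => a b [/=]; rewrite !coordE /= => h1 h2 h3.
have a0 : a 0 0 = 0 by lra.
have b1 : b 1 0 = 0 by lra.
have b0 : b 0 0 = - a 1 0 by lra.
by congr pair; apply: cV3P; rewrite !coordE /= ?a0 ?b1 ?b0; field.
Qed.

(* All terms are rotation invariant, so it suffices to compute at [std], where
   the linear constraints on [p], [X] and [Y] can be solved explicitly. *)
Lemma omegaE eta z X Y :
  stiefel z.1 -> tangent_eqs z.1 z.2 -> tangent2_eqs z X -> tangent2_eqs z Y ->
  omega eta X Y =
    dot (dmom z X) (angvel z.1 Y.1) - dot (dmom z Y) (angvel z.1 X.1)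
    - dot (cross (mom z.1 z.2 + vec3 0 0 (- eta)) (angvel z.1 X.1))
          (angvel z.1 Y.1).
Proof.
case: z => e p /= se; have SQ := frame_SO3 se.
rewrite -(rotate_std e) -(rotateK SQ p); move: (rotate _ p) => {}p.
set Q := frame e in SQ *.
have rotate2K (Z : phase R) : Z = rotate2 Q (rotate2 Q^T Z).
  by case: Z => x1 x2; rewrite /rotate2 /= !rotateK.
rewrite (rotate2K X) (rotate2K Y); move: (rotate2 _ X) (rotate2 _ Y) => {}X {}Y.
rewrite -[(rotate Q std, rotate Q p)]/(rotate2 Q (std, p)) !tangent2_rotate //.
rewrite !tangent_rotate // omega_rotate // !dmom_rotate // mom_rotate //.
rewrite !angvel_rotate //.
case: p X Y => p1 p2 [[a1 a2] [q1 q2]] [[c1 c2] [r1 r2]].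
move=> [/=]; rewrite !coordE /= => h1 h2 h3.
move=> [[/=]]; rewrite !coordE /= => h4 h5 h6 [h7 h8 h9].
move=> [[/=]]; rewrite !coordE /= => k4 k5 k6 [k7 k8 k9].
have p10 : p1 0 0 = 0 by lra.
have p21 : p2 1 0 = 0 by lra.
have p20 : p2 0 0 = - p1 1 0 by lra.
have a10 : a1 0 0 = 0 by lra.
have a21 : a2 1 0 = 0 by lra.
have a20 : a2 0 0 = - a1 1 0 by lra.
have c10 : c1 0 0 = 0 by lra.
have c21 : c2 1 0 = 0 by lra.
have c20 : c2 0 0 = - c1 1 0 by lra.
move: h7 h8 h9 k7 k8 k9; rewrite p10 p21 p20 a10 a21 a20 c10 c21 c20.
move=> h7 h8 h9 k7 k8 k9.
have q10 : q1 0 0 = - (a1 1 0 * p1 1 0 + a1 2 0 * p1 2 0) by lra.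
have q21 : q2 1 0 = - (a1 1 0 * p1 1 0 + a2 2 0 * p2 2 0) by lra.
have r10 : r1 0 0 = - (c1 1 0 * p1 1 0 + c1 2 0 * p1 2 0) by lra.
have r21 : r2 1 0 = - (c1 1 0 * p1 1 0 + c2 2 0 * p2 2 0) by lra.
have q20 : q2 0 0 = - (a1 2 0 * p2 2 0 + a2 2 0 * p1 2 0 + q1 1 0) by lra.
have r20 : r2 0 0 = - (c1 2 0 * p2 2 0 + c2 2 0 * p1 2 0 + r1 1 0) by lra.
rewrite /omega /pairing /= !coordE ?p10 ?p21 ?p20 ?a10 ?a21 ?a20 ?c10 ?c21 ?c20.
rewrite q10 q21 q20 r10 r21 r20.
by field.
Qed.

(* The witness is the derivative of [p = R p0] for [R' = R w^], with [p0] the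
   vector of body coordinates, whose free components vary by [m]. *)
Lemma tangent2_surj z (w m : 'cV[R]_3) :
  stiefel z.1 -> tangent_eqs z.1 z.2 ->
  exists X, [/\ tangent2_eqs z X, angvel z.1 X.1 = w & dmom z X = m].
Proof.
case: z => e p /= se; have SQ := frame_SO3 se.
rewrite -(rotate_std e) -(rotateK SQ p); move: (rotate _ p) => {}p.
set Q := frame e in SQ *; rewrite tangent_rotate // => tp.
exists (rotate2 Q (rigid std w,
  (cross w p.1 + vec3 0 (2^-1 * m 2 0) (- m 1 0),
   cross w p.2 + vec3 (- (2^-1 * m 2 0)) 0 (m 0 0)))).
rewrite angvel_rotate // angvel_rigid; last exact: stiefel_std.
rewrite -[(rotate Q std, rotate Q p)]/(rotate2 Q (std, p)).
rewrite dmom_rotate //.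
case: p tp => p1 p2 [/=]; rewrite !coordE /= => h1 h2 h3.
have p10 : p1 0 0 = 0 by lra.
have p21 : p2 1 0 = 0 by lra.
have p20 : p2 0 0 = - p1 1 0 by lra.
split=> //; [apply/tangent2_rotate => //; split; split|apply: cV3P];
  by rewrite /= !coordE ?p10 ?p21 ?p20; field.
Qed.

Lemma tangent2_euler eta (A : 'M[R]_3) z X :
  A^T = A -> stiefel z.1 -> tangent_eqs z.1 z.2 -> tangent2_eqs z X ->
  let M := mom z.1 z.2 in
  (forall Y, tangent2_eqs z Y -> omega eta X Y = - dot (A *m M) (dmom z Y)) <->
  angvel z.1 X.1 = A *m M /\
  dmom z X = cross (M + vec3 0 0 (- eta)) (A *m M).
Proof.
move=> AT se tp tX M; split=> [h|[hw hm] Y tY]; last first.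
  by rewrite (omegaE eta se tp tX tY) -/M hw hm [dot (A *m M) _]dot_sym; ring.
have hdot w m : dot (dmom z X) w - dot m (angvel z.1 X.1)
    - dot (cross (M + vec3 0 0 (- eta)) (angvel z.1 X.1)) w
    = - dot (A *m M) m.
  by have [Y [tY <- <-]] := tangent2_surj w m se tp;
    rewrite -(omegaE eta se tp tX tY) h.
have dot0 u : dot u 0 = 0 :> R by rewrite dotE !mxE; ring.
(* Test vectors with zero angular velocity isolate this equation; those with zero momentum variation
   then give the other one. *)
have hw : angvel z.1 X.1 = A *m M.
  apply: dot_inj => m; have := hdot 0 m; rewrite !dot0.
  by rewrite [dot m _]dot_sym; lra.
split=> //; apply: dot_inj => w; have := hdot w 0; rewrite hw.
by rewrite (dot_sym 0) !dot0; lra.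
Qed.

End Stiefel.
Arguments std {R}.

(** * Derivative rules for the vector operations *)

Section DeriveFormulas.
Variables (R : realType) (V : normedModType R).
Implicit Types (x v : V).

Lemma is_derive_cVP (f : V -> 'cV[R]_3) df x v :
  is_derive x v f df <-> forall i, is_derive x v (fun y => f y i 0) (df i 0).
Proof.
rewrite is_derive_mxP; split=> h i; first exact: h.
by move=> j; rewrite (ord1 j); exact: h.
Qed.

(** This rule and the next two are put in the form [fun y => ...] so that proof terms for compound
    expressions compose by unification. *)
Lemma is_derive_sub (W : normedModType R) (f g : V -> W) df dg x v :
  is_derive x v f df -> is_derive x v g dg ->
  is_derive x v (fun y => f y - g y) (df - dg).
Proof. by move=> fx gx; exact: is_deriveB. Qed.

Lemma is_derive_add (W : normedModType R) (f g : V -> W) df dg x v :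
  is_derive x v f df -> is_derive x v g dg ->
  is_derive x v (fun y => f y + g y) (df + dg).
Proof. by move=> fx gx; exact: is_deriveD. Qed.

Lemma is_derive_opp (W : normedModType R) (f : V -> W) df x v :
  is_derive x v f df -> is_derive x v (fun y => - f y) (- df).
Proof. by move=> fx; exact: is_deriveN. Qed.

Lemma is_derive_dot (f g : V -> 'cV[R]_3) df dg x v :
  is_derive x v f df -> is_derive x v g dg ->
  is_derive x v (fun y => dot (f y) (g y)) (dot df (g x) + dot (f x) dg).
Proof.
move=> /is_derive_cVP fx /is_derive_cVP gx.
rewrite [X in is_derive _ _ X](_ : _ = fun y =>
  f y 0 0 * g y 0 0 + f y 1 0 * g y 1 0 + f y 2 0 * g y 2 0); last first.
  by apply/funext => y; rewrite dotE.
by apply: is_derive_eq; rewrite /= !dotE /GRing.scale /=; ring.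
Qed.

Lemma is_derive_vec3 (f g h : V -> R) df dg dh x v :
  is_derive x v f df -> is_derive x v g dg -> is_derive x v h dh ->
  is_derive x v (fun y => vec3 (f y) (g y) (h y)) (vec3 df dg dh).
Proof.
move=> fx gx hx; apply/is_derive_cVP => i; rewrite mxE.
under eq_fun do rewrite mxE.
by case: (ord3P i) => ->.
Qed.

Lemma is_derive_coord (f : V -> 'cV[R]_3) df i x v :
  is_derive x v f df -> is_derive x v (fun y => f y i 0) (df i 0).
Proof. by move=> /is_derive_cVP. Qed.

Lemma is_derive_cross (f g : V -> 'cV[R]_3) df dg x v :
  is_derive x v f df -> is_derive x v g dg ->
  is_derive x v (fun y => cross (f y) (g y)) (cross df (g x) + cross (f x) dg).
Proof.
move=> /is_derive_cVP fx /is_derive_cVP gx; apply: is_derive_eq.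
  by apply: is_derive_vec3; apply: is_derive_sub; apply: is_derive_mul;
    first [exact: fx|exact: gx].
by apply: cV3P; rewrite !coordE /GRing.scale /=; ring.
Qed.

Lemma is_derive_scale (k : V -> R) (f : V -> 'cV[R]_3) dk df x v :
  is_derive x v k dk -> is_derive x v f df ->
  is_derive x v (fun y => k y *: f y) (dk *: f x + k x *: df).
Proof.
move=> kx /is_derive_cVP fx; apply/is_derive_cVP => i; rewrite !mxE.
under eq_fun do rewrite mxE.
by apply: is_derive_mul.
Qed.

Lemma is_derive_mulmxv (A : 'M[R]_3) (f : V -> 'cV[R]_3) df x v :
  is_derive x v f df -> is_derive x v (fun y => A *m f y) (A *m df).
Proof.
move=> /is_derive_cVP fx; apply/is_derive_cVP => i; rewrite mulmxvE.
under eq_fun do rewrite mulmxvE.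
exact: is_derive_add.
Qed.

Lemma is_derive_unique (W : normedModType R) (f : V -> W) df df' x v :
  is_derive x v f df -> is_derive x v f df' -> df = df'.
Proof. by move=> [_ <-] [_ <-]. Qed.

End DeriveFormulas.

(** * Derivatives of the constraints, the momentum and the frame *)

Section DerivePhase.
Variables (R : realType) (V : normedModType R).
Implicit Types (x v : V).

(** The [- 0] is the derivative of the constant 1, kept so that the entries are literally what the
    derivative rules produce. *)
Definition dstiefel_eqs (i : 'I_3) (e v : pair3 R) : R :=
  [:: dot v.1 e.1 + dot e.1 v.1 - 0; dot v.2 e.2 + dot e.2 v.2 - 0;
      dot v.1 e.2 + dot e.1 v.2]`_i.

Lemma is_derive_stiefel_eqs (F : V -> pair3 R) dF i x v :
  is_derive x v F dF ->
  is_derive x v (fun y => stiefel_eqs i (F y)) (dstiefel_eqs i (F x) dF).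
Proof.
move=> hF; have h1 := is_derive_fst hF; have h2 := is_derive_snd hF.
have hc : is_derive x v (fun _ : V => 1 : R) 0 by exact: is_derive_cst.
rewrite /stiefel_eqs /dstiefel_eqs; case: (ord3P i) => -> /=.
- exact: is_derive_sub (is_derive_dot h1 h1) hc.
- exact: is_derive_sub (is_derive_dot h2 h2) hc.
- exact: is_derive_dot h1 h2.
Qed.

Definition dcotangent_eqs (i : 'I_6) (z X : phase R) : R :=
  [:: dot X.1.1 z.1.1 + dot z.1.1 X.1.1 - 0;
      dot X.1.2 z.1.2 + dot z.1.2 X.1.2 - 0;
      dot X.1.1 z.1.2 + dot z.1.1 X.1.2;
      dot X.1.1 z.2.1 + dot z.1.1 X.2.1;
      dot X.1.2 z.2.2 + dot z.1.2 X.2.2;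
      dot X.1.1 z.2.2 + dot z.1.1 X.2.2
      + (dot X.1.2 z.2.1 + dot z.1.2 X.2.1)]`_i.

Lemma is_derive_cotangent_eqs (F : V -> phase R) dF i x v :
  is_derive x v F dF ->
  is_derive x v (fun y => cotangent_eqs i (F y)) (dcotangent_eqs i (F x) dF).
Proof.
move=> hF; have he := is_derive_fst hF; have hp := is_derive_snd hF.
have h1 := is_derive_fst he; have h2 := is_derive_snd he.
have k1 := is_derive_fst hp; have k2 := is_derive_snd hp.
have hc : is_derive x v (fun _ : V => 1 : R) 0 by exact: is_derive_cst.
rewrite /cotangent_eqs /dcotangent_eqs.
case: i => [[|[|[|[|[|[|//]]]]]] ?] /=.
- exact: is_derive_sub (is_derive_dot h1 h1) hc.
- exact: is_derive_sub (is_derive_dot h2 h2) hc.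
- exact: is_derive_dot h1 h2.
- exact: is_derive_dot h1 k1.
- exact: is_derive_dot h2 k2.
- exact: is_derive_add (is_derive_dot h1 k2) (is_derive_dot h2 k1).
Qed.

Lemma is_derive_mom (F : V -> phase R) dF x v :
  is_derive x v F dF ->
  is_derive x v (fun y => mom (F y).1 (F y).2) (dmom (F x) dF).
Proof.
move=> hF; have he := is_derive_fst hF; have hp := is_derive_snd hF.
have h1 := is_derive_fst he; have h2 := is_derive_snd he.
have k1 := is_derive_fst hp; have k2 := is_derive_snd hp.
have h3 := is_derive_cross h1 h2.
rewrite /mom /dmom; apply: is_derive_vec3.
- exact: is_derive_dot k2 h3.
- exact: is_derive_opp (is_derive_dot k1 h3).
- exact: is_derive_sub (is_derive_dot k1 h2) (is_derive_dot k2 h1).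
Qed.

Definition dframe (e v : pair3 R) : 'M[R]_3 :=
  \matrix_(i, j)
    ([:: v.1; v.2; cross v.1 e.2 + cross e.1 v.2]`_j) i 0.

Lemma is_derive_frame (F : V -> pair3 R) dF x v :
  is_derive x v F dF ->
  is_derive x v (fun y => frame (F y)) (dframe (F x) dF).
Proof.
move=> hF; have h1 := is_derive_fst hF; have h2 := is_derive_snd hF.
have h3 := is_derive_cross h1 h2.
apply/is_derive_mxP => i j; rewrite mxE.
under eq_fun do rewrite mxE.
case: (ord3P j) => -> /=; exact: is_derive_coord.
Qed.

(** [F] consists of the first two columns of its frame. With [is_derive_rigid] this recovers the
    differentiability of a phase curve from that of its image under [to_body]. *)
Lemma is_derive_frame_inv (F : V -> pair3 R) dQ x v :
  is_derive x v (fun y => frame (F y)) dQ -> exists dF, is_derive x v F dF.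
Proof.
move=> /is_derive_mxP hQ; exists (\col_i dQ i 0, \col_i dQ i 1).
rewrite [F](_ : _ = fun y => ((F y).1, (F y).2)); last first.
  by apply/funext => y; case: (F y).
apply: is_derive_pair; apply/is_derive_cVP => i; rewrite mxE.
- rewrite [X in is_derive _ _ X](_ : _ = fun y => frame (F y) i 0) //.
  by apply/funext => y; rewrite mxE.
- rewrite [X in is_derive _ _ X](_ : _ = fun y => frame (F y) i 1) //.
  by apply/funext => y; rewrite mxE.
Qed.

(** Existence suffices: the velocity is identified later, by uniqueness of derivatives. *)
Lemma is_derive_rigid (F : V -> pair3 R) (w : V -> 'cV[R]_3) dF dw x v :
  is_derive x v F dF -> is_derive x v w dw ->
  exists dp, is_derive x v (fun y => rigid (F y) (w y)) dp.
Proof.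
move=> hF hw; have h1 := is_derive_fst hF; have h2 := is_derive_snd hF.
have h3 := is_derive_cross h1 h2.
eexists; apply: is_derive_pair.
- exact: is_derive_sub (is_derive_scale (is_derive_coord 2 hw) h2)
    (is_derive_scale (is_derive_coord 1 hw) h3).
- exact: is_derive_sub (is_derive_scale (is_derive_coord 0 hw) h3)
    (is_derive_scale (is_derive_coord 2 hw) h1).
Qed.

End DerivePhase.

(** * Tangent spaces and the identification with SO(3) x R^3 *)

Section Phase.
Variable R : realType.
Implicit Types (e p v : pair3 R) (z X Y : phase R) (Q : 'M[R]_3).
Implicit Types (w M : 'cV[R]_3).

Lemma tangent_stiefelP e v : tangent_stiefel e v <-> tangent_eqs e v.
Proof.
have D i : 'D_v (stiefel_eqs i) e = dstiefel_eqs i e v.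
  by have [_ <-] := is_derive_stiefel_eqs i (is_derive_id e v).
split=> [h|[h1 h2 h3] i].
  have := h 0; have := h 1; have := h 2.
  rewrite !D /dstiefel_eqs /= (dot_sym v.1 e.1) (dot_sym v.2 e.2) => h2 h1 h0.
  by split; [lra|lra|rewrite (dot_sym e.2 v.1); lra].
rewrite D /dstiefel_eqs; case: (ord3P i) => -> /=.
- by rewrite dot_sym h1; lra.
- by rewrite dot_sym h2; lra.
- by rewrite dot_sym addrC.
Qed.

Lemma tangent2_eqsP z X :
  (forall i, dcotangent_eqs i z X = 0) <-> tangent2_eqs z X.
Proof.
split=> [h|[[h1 h2 h3] [h4 h5 h6]] i].
  have := h 0; have := h (inord 1); have := h (inord 2).
  have := h (inord 3); have := h (inord 4); have := h (inord 5).
  rewrite /dcotangent_eqs !inordK //= (dot_sym X.1.1 z.1.1).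
  rewrite (dot_sym X.1.2 z.1.2) (dot_sym X.1.1 z.1.2) => h6 h5 h4 h3 h2 h1.
  by split; [split; lra|].
rewrite /dcotangent_eqs.
case: i => [[|[|[|[|[|[|//]]]]]] ?] //=.
- by rewrite dot_sym h1; lra.
- by rewrite dot_sym h2; lra.
- by rewrite dot_sym addrC.
Qed.

Lemma tangent_cotangentP z X : tangent_cotangent z X <-> tangent2_eqs z X.
Proof.
have D i : 'D_X (cotangent_eqs i) z = dcotangent_eqs i z X.
  by have [_ <-] := is_derive_cotangent_eqs i (is_derive_id z X).
by rewrite -tangent2_eqsP; split=> h i; have := h i; rewrite D.
Qed.

(** The kinematic relation R' = R w^. With [v] written as [rigid e w], the factor [frame e] comes
    out on the left, and at [std] the derivative of the frame is [hat w]. *)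
Lemma dframeE e v :
  stiefel e -> tangent_eqs e v -> dframe e v = frame e *m hat (angvel e v).
Proof.
move=> se tv; rewrite -{1}(rigid_angvel se tv); move: (angvel _ _) => w.
have SQ := frame_SO3 se; set Q := frame e in SQ *.
rewrite -(rotate_std e) -/Q rigid_rotate //.
have -> : dframe (rotate Q std) (rotate Q (rigid std w))
    = Q *m dframe std (rigid std w).
  apply/matrixP => i j; rewrite [LHS]mxE /= !cross_SO3 // -mulmxDr [RHS]mxE.
  case: (ord3P j) => -> /=; rewrite [LHS]mxE; apply: eq_bigr => k _;
    by congr (_ * _); rewrite [RHS]mxE.
congr (Q *m _); apply/matrixP => i j; rewrite !mxE.
by case: (ord3P i) => ->; case: (ord3P j) => -> /=; rewrite !coordE /=; ring.
Qed.

(** [wedge] turns a rotation of its arguments into a conjugation, which cancels against the frame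
    and leaves the entries of [Phi0] at [std]. *)
Lemma body_momentumE z : stiefel z.1 -> body_momentum z = mom z.1 z.2.
Proof.
case: z => e p /= se; have SQ := frame_SO3 se; rewrite /body_momentum /Phi0 /=.
set Q := frame e in SQ *; rewrite -(rotate_std e) -/Q -(rotateK SQ p).
move: (rotate _ p) => {}p; rewrite mom_rotate //=.
have wedge_mul u w : wedge (Q *m u) (Q *m w) = Q *m wedge u w *m Q^T.
  by rewrite /wedge !trmx_mul mulmxBr mulmxBl !mulmxA.
rewrite !wedge_mul -mulmxDl -mulmxDr !mulmxA SO3_mulV // mul1mx -mulmxA.
rewrite SO3_mulV // mulmx1.
apply: cV3P; rewrite !coordE !mxE !big_ord_recl !big_ord0 !mxE /=; ring.
Qed.

(* The half comes from [M_3 = <p1, e2> - <p2, e1> = 2 <p1, e2>]. *)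
Definition momentum_at e M : pair3 R :=
  rigid e (vec3 (M 0 0) (M 1 0) (2^-1 * M 2 0)).

Lemma mom_momentum_at e M : stiefel e -> mom e (momentum_at e M) = M.
Proof.
move=> se; have h := angvel_rigid (vec3 (M 0 0) (M 1 0) (2^-1 * M 2 0)) se.
rewrite /momentum_at; move: (rigid _ _) h => p.
rewrite /angvel /mom => h.
have := congr1 (fun u : 'cV[R]_3 => u 0 0) h.
have := congr1 (fun u : 'cV[R]_3 => u 1 0) h.
have := congr1 (fun u : 'cV[R]_3 => u 2 0) h.
rewrite !vec3E => h2 h1 h0; apply: cV3P; rewrite !vec3E //.
by move: h2 => /mulfI; apply; rewrite invr_eq0 pnatr_eq0.
Qed.

Lemma momentum_at_mom e p :
  stiefel e -> tangent_eqs e p -> momentum_at e (mom e p) = p.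
Proof.
by move=> se tp; rewrite -[RHS](rigid_angvel se tp) /momentum_at /mom !vec3E.
Qed.

Lemma to_body_bij :
  set_bij (@cotangent_stiefel R) (SO3 `*` [set: 'cV[R]_3]) to_body.
Proof.
split.
- move=> z /cotangentP[se _]; split=> //; exact: frame_SO3.
- move=> [e p] [e' p'] /[!inE] /cotangentP[/= se tp] /cotangentP[/= se' tp'].
  move=> [fe]; rewrite !body_momentumE //= => hm.
  (* [frame] is injective, because [e] is the image of [std] under it. *)
  have ee : e = e' by rewrite -(rotate_std e) fe rotate_std.
  congr pair => //; rewrite -(momentum_at_mom se tp) -(momentum_at_mom se' tp').
  by rewrite hm ee.
- move=> [Q M] [/= SQ _].
  have se := stiefel_rotate SQ (@stiefel_std R).
  exists (rotate Q std, momentum_at (rotate Q std) M).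
    by apply/cotangentP; split=> //; exact: tangent_rigid.
  by rewrite /to_body body_momentumE //= frame_rotate_std // mom_momentum_at.
Qed.

End Phase.

(** * Inverses of positive definite symmetric matrices *)

Section SymmetricMatrix.
Variables (R : realType) (A : 'M[R]_3).
Hypothesis AT : A^T = A.
Hypothesis Apos : forall u : 'cV[R]_3, u != 0 -> 0 < dot u (A *m u).

Lemma posdef_unitmx : A \in unitmx.
Proof.
rewrite unitmxE unitfE; apply/negP => /eqP/eqP /det0P[u u0 uA].
(* The null vector [u] is a row; by symmetry of [A] its transpose is a null column, against
   positivity. *)
have uT0 : u^T != 0 by rewrite -[0]trmx0 (inj_eq trmx_inj).
by have := Apos uT0; rewrite -AT -trmx_mul uA trmx0 dotE !mxE;
  rewrite !mulr0 !addr0 ltxx.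
Qed.

Lemma posdef_invmx : inertia_operator (invmx A).
Proof.
split=> [|u u0]; first by rewrite trmx_inv AT.
have u' : invmx A *m u != 0.
  by apply: contra u0 => /eqP h; rewrite -(mulKVmx posdef_unitmx u) h mulmx0.
by have := Apos u'; rewrite mulKVmx ?posdef_unitmx // dot_sym.
Qed.

End SymmetricMatrix.

(** * The Hamiltonian as a quadratic form in the body momentum *)

Section Energy.
Variables (R : realType) (b1 b2 b3 b4 b5 b6 : R).
Local Notation A := (Ab b1 b2 b3 b4 b5 b6).
Local Notation H := (Hb b1 b2 b3 b4 b5 b6).

Lemma trmx_Ab : A^T = A.
Proof.
apply/matrixP => i j; rewrite !mxE.
by case: (ord3P i) => ->; case: (ord3P j) => ->.
Qed.

(** Since [mom] is (<p2,e3>, -<p1,e3>, -Psi), the products with b4 and b6 contain one negated factor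
    and that with b5 two: hence the signs in [Ab]. The identity holds on all of R^12, so it can be
    differentiated in every direction. *)
Lemma HbE z : H z = 2^-1 * dot (A *m mom z.1 z.2) (mom z.1 z.2).
Proof.
rewrite [dot (_ *m _) _]dotE !mulmxvE !vec3E !mxE /= /Hb /Psi.
by rewrite (dot_sym z.1.1) (dot_sym z.1.2); field.
Qed.

Lemma derive_Hb z Y : 'D_Y H z = dot (A *m mom z.1 z.2) (dmom z Y).
Proof.
have hm := is_derive_mom (is_derive_id z Y).
have hd := is_derive_dot (is_derive_mulmxv A hm) hm.
have hc : is_derive z Y (fun _ : phase R => 2^-1 : R) 0 by exact: is_derive_cst.
have := is_derive_mul hc hd.
rewrite (_ : (fun _ => _) = H); last by apply/funext => y; rewrite HbE.
move=> [_ ->] /=; rewrite [dot (A *m dmom z Y) _]dot_trmx trmx_Ab.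
by rewrite [dot (dmom z Y) _]dot_sym; field.
Qed.

(** Every [u] is the momentum of a covector at [std], so positivity on this one fibre is enough. *)
Lemma Ab_posdef : momenta_posdef H ->
  forall u : 'cV[R]_3, u != 0 -> 0 < dot u (A *m u).
Proof.
move=> Hpos u u0; pose z : phase R := (std, momentum_at std u).
have se := stiefel_std R.
have mz : mom z.1 z.2 = u by rewrite mom_momentum_at.
have : 0 < H z.
  apply: Hpos; first by apply/cotangentP; split=> //; exact: tangent_rigid.
  apply: contra u0 => /eqP z0; rewrite -mz z0.
  by apply/eqP/cV3P; rewrite !coordE !mxE /=; ring.
by rewrite HbE mz dot_sym pmulr_rgt0 // invr_gt0.
Qed.

End Energy.

(** * Hamiltonian curves and gyrostat motions *)

Section Dynamics.
Variable R : realType.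

Lemma near_open (J : set R) (P : R -> Prop) t :
  open J -> J t -> (forall s, J s -> P s) -> \forall s \near t, P s.
Proof.
by move=> oJ Jt h; apply: filterS (open_nbhs_nbhs (conj oJ Jt)).
Qed.

Section Velocity.
Variables (J : set R) (gamma : R -> phase R) (t : R) (X : phase R).
Hypotheses (oJ : open J) (Jt : J t).
Hypothesis Jgamma : forall s, J s -> cotangent_stiefel (gamma s).
Hypothesis dgamma : is_derive t (1 : R) gamma X.

(** Along [gamma] the constraints vanish on a whole neighbourhood of [t], so their derivatives
    vanish at [t]. *)
Lemma velocity_tangent2 : tangent2_eqs (gamma t) X.
Proof.
apply/tangent2_eqsP => i.
apply: (is_derive_unique (is_derive_cotangent_eqs i dgamma)).
have h0 : is_derive t (1 : R) (fun _ : R => 0 : R) 0 by exact: is_derive_cst.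
apply: near_eq_is_derive h0.
by apply: near_open oJ Jt _ => s /Jgamma ->.
Qed.

Lemma velocity_frame : is_derive t (1 : R) (fun s => frame (gamma s).1)
  (frame (gamma t).1 *m hat (angvel (gamma t).1 X.1)).
Proof.
have [se _] := (cotangentP _).1 (Jgamma Jt).
rewrite -(dframeE se velocity_tangent2.1).
exact: is_derive_frame (is_derive_fst dgamma).
Qed.

Lemma velocity_momentum L : is_derive t (1 : R)
  (fun s => body_momentum (gamma s) + L) (dmom (gamma t) X).
Proof.
apply: (near_eq_is_derive (f := fun s => mom (gamma s).1 (gamma s).2 + L)).
  apply: near_open oJ Jt _ => s /Jgamma/cotangentP[se _].
  by rewrite body_momentumE.
rewrite -[dmom _ _]addr0; exact: is_derive_add (is_derive_mom dgamma) _.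
Qed.

End Velocity.

(** Near [t] the curve is (e, [momentum_at e M]), with [e] read off the frame and [M] the body
    momentum, and this expression is differentiable in [e] and [M]. *)
Lemma is_derive_phase (J : set R) (gamma : R -> phase R) t L dQ dM :
  open J -> J t -> (forall s, J s -> cotangent_stiefel (gamma s)) ->
  is_derive t (1 : R) (fun s => frame (gamma s).1) dQ ->
  is_derive t (1 : R) (fun s => body_momentum (gamma s) + L) dM ->
  exists X, is_derive t (1 : R) gamma X.
Proof.
move=> oJ Jt Jgamma hQ hM; have [de he] := is_derive_frame_inv hQ.
have hL : is_derive t (1 : R) (fun _ : R => L) 0 by exact: is_derive_cst.
have hM' := is_derive_sub hM hL.
have hc : is_derive t (1 : R) (fun _ : R => 2^-1 : R) 0 by exact: is_derive_cst.
have [dp hp] := is_derive_rigid he (is_derive_vec3 (is_derive_coord 0 hM')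
  (is_derive_coord 1 hM') (is_derive_mul hc (is_derive_coord 2 hM'))).
exists (de, dp); apply: near_eq_is_derive (is_derive_pair he hp).
apply: near_open oJ Jt _ => s /Jgamma/cotangentP[se tp].
rewrite !addrK -/(momentum_at _ _) body_momentumE // momentum_at_mom //.
by case: (gamma s).
Qed.

Lemma hamiltonian_gyrostat eta (A : 'M[R]_3) (H : phase R -> R) (J : set R)
    (gamma : R -> phase R) :
  A^T = A -> A \in unitmx ->
  (forall z Y, 'D_Y H z = dot (A *m mom z.1 z.2) (dmom z Y)) ->
  open J -> (forall t, J t -> cotangent_stiefel (gamma t)) ->
  hamiltonian_curve eta H J gamma <->
  gyrostat_motion (invmx A) (vec3 0 0 (- eta)) J
    (fun t => frame (gamma t).1) (fun t => body_momentum (gamma t)).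
Proof.
move=> AT uA DH oJ Jgamma.
(* Once a velocity [X] is known to exist, the equivalence is pointwise in [t]; only the converse has
   to construct [X]. *)
suff key t X : J t -> is_derive t (1 : R) gamma X ->
    hamiltonian_vector eta H (gamma t) X <->
    angvel (gamma t).1 X.1 = A *m body_momentum (gamma t) /\
    dmom (gamma t) X = cross (body_momentum (gamma t) + vec3 0 0 (- eta))
                             (A *m body_momentum (gamma t)).
  split=> [h t Jt|h t Jt].
    have [dg hX] := h t Jt; have hg := derivableP dg.
    have [hw hm] := (key _ _ Jt hg).1 hX; rewrite /= invmxK -hm -hw; split.
      exact: velocity_momentum oJ Jt Jgamma hg _.
    exact: velocity_frame oJ Jt Jgamma hg.
  have := h t Jt; rewrite /= invmxK => -[hM hQ].
  have [X hX] := is_derive_phase oJ Jt Jgamma hQ hM.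
  have [dg eX] := hX; split=> //; rewrite eX; apply/key => //; split.
    have [se _] := (cotangentP _).1 (Jgamma _ Jt).
    have := is_derive_unique (velocity_frame oJ Jt Jgamma hX) hQ.
    (* Two expressions for R' are compared: cancelling R leaves equal skew matrices, hence equal
       angular velocities. *)
    move=> /(congr1 (mulmx (frame (gamma t).1)^T)).
    by rewrite !mulmxA (SO3_mulV (frame_SO3 se)) !mul1mx => /hat_inj.
  exact: is_derive_unique (velocity_momentum oJ Jt Jgamma hX _) hM.
move=> Jt hX; have [se tp] := (cotangentP _).1 (Jgamma _ Jt).
have tX := velocity_tangent2 oJ Jt Jgamma hX.
rewrite body_momentumE // -(tangent2_euler eta AT se tp tX).
split=> [[_ h] Y tY|h].
  by rewrite h ?DH //; apply/tangent_cotangentP.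
by split=> [|Y /tangent_cotangentP tY]; [exact/tangent_cotangentP|rewrite DH h].
Qed.

End Dynamics.

(** * Smoothness of polynomial functions *)

Section Smooth.
Variables (R : realType) (V : normedModType R).

(** A class of differentiable functions stable under every directional derivative, by the Leibniz
    rule. The base case, with derivatives constant in [x], covers constants and coordinates
    alike. *)
Inductive polyfun : (V -> R) -> Prop :=
| polyfun_affine f : (forall x, differentiable f x) ->
    (forall v, exists c, forall x, 'D_v f x = c) -> polyfun f
| polyfunD f g : polyfun f -> polyfun g -> polyfun (fun x => f x + g x)
| polyfunM f g : polyfun f -> polyfun g -> polyfun (fun x => f x * g x).

Lemma polyfun_cst (c : R) : polyfun (fun _ => c).
Proof.
apply: polyfun_affine => [x|v]; first exact: differentiable_cst.
by exists 0 => x; exact: derive_cst.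
Qed.

Lemma polyfunN f : polyfun f -> polyfun (fun x => - f x).
Proof.
move=> pf; rewrite (_ : (fun _ => _) = fun x => -1 * f x); last first.
  by apply/funext => x; rewrite mulN1r.
exact: polyfunM (polyfun_cst _) pf.
Qed.

Lemma polyfun_differentiable f : polyfun f -> forall x, differentiable f x.
Proof.
elim=> // {}f g _ fd _ gd x; first exact: differentiableD.
exact: differentiableM.
Qed.

Lemma polyfun_derive f : polyfun f -> forall v, polyfun ('D_v f).
Proof.
elim=> [{}f _ fc v|{}f g pf fd pg gd v|{}f g pf fd pg gd v].
- have [c hc] := fc v; rewrite (_ : 'D_v f = fun _ => c); last exact/funext.
  exact: polyfun_cst.
- rewrite (_ : 'D_v _ = fun x => 'D_v f x + 'D_v g x).
    exact: polyfunD.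
  apply/funext => x; apply: deriveD; apply: diff_derivable;
    exact: polyfun_differentiable.
- rewrite (_ : 'D_v _ = fun x => 'D_v f x * g x + f x * 'D_v g x).
    by apply: polyfunD; exact: polyfunM.
  apply/funext => x.
  have [_ ->] // := is_derive_mul
    (derivableP (diff_derivable (v := v) (polyfun_differentiable pf x)))
    (derivableP (diff_derivable (v := v) (polyfun_differentiable pg x))).
Qed.

Lemma polyfun_smooth f : polyfun f -> smooth f.
Proof.
move=> pf vs x; apply: polyfun_differentiable.
by elim: vs => //= v vs IH; exact: polyfun_derive.
Qed.

End Smooth.

(** * The invariant metric and its kinetic energy *)

Section Metric.
Variable R : realType.
Implicit Types (e v w : pair3 R).

Lemma polyfun_coord1 i : polyfun (fun e : pair3 R => e.1 i 0).
Proof.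
apply: polyfun_affine => [x|v].
  apply: (@differentiable_comp _ _ _ _ fst (fun u : 'cV[R]_3 => u i 0)).
    by apply: linear_differentiable => y; exact: cvg_fst.
  exact: differentiable_coord.
exists (v.1 i 0) => x.
by have [_] := is_derive_coord i (is_derive_fst (is_derive_id x v)).
Qed.

Lemma polyfun_coord2 i : polyfun (fun e : pair3 R => e.2 i 0).
Proof.
apply: polyfun_affine => [x|v].
  apply: (@differentiable_comp _ _ _ _ snd (fun u : 'cV[R]_3 => u i 0)).
    by apply: linear_differentiable => y; exact: cvg_snd.
  exact: differentiable_coord.
exists (v.2 i 0) => x.
by have [_] := is_derive_coord i (is_derive_snd (is_derive_id x v)).
Qed.

Definition rigid_metric (B : 'M[R]_3) e v w : R :=
  dot (angvel e v) (B *m angvel e w).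

(** For fixed [v] the components of [angvel e v] are polynomials in the coordinates of [e] on all of
    R^6. *)
Lemma rigid_metric_smooth B v w : smooth (fun e => rigid_metric B e v w).
Proof.
apply: polyfun_smooth.
under eq_fun do rewrite /rigid_metric dotE !mulmxvE !coordE.
repeat first [exact: polyfun_coord1 | exact: polyfun_coord2
  | exact: polyfun_cst | apply: polyfunD | apply: polyfunM | apply: polyfunN].
Qed.

Lemma angvel_linear e (a : R) v w :
  angvel e (a *: v + w) = a *: angvel e v + angvel e w.
Proof. by apply: cV3P; rewrite /= !coordE /=; ring. Qed.

Lemma rigid_metric_riemannian B :
  inertia_operator B -> riemannian_metric (rigid_metric B).
Proof.
move=> [BT Bpos]; split.
- exact: rigid_metric_smooth.
- move=> e a u v w; rewrite /rigid_metric angvel_linear.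
  by move: (angvel _ _) (angvel _ _) (B *m _) => x y z; rewrite !coordE; ring.
- by move=> e v w; rewrite /rigid_metric dot_sym dot_trmx BT.
- move=> e v se /tangent_stiefelP tv v0; apply: Bpos.
  apply: contra v0 => /eqP w0; rewrite -(rigid_angvel se tv) w0 /rigid !mxE.
  by rewrite !scale0r !subr0.
Qed.

Lemma rigid_metric_invariant B : SO3_invariant (rigid_metric B).
Proof.
by move=> Q e v w SQ se _ _; rewrite /rigid_metric !angvel_rotate.
Qed.

(** Testing the duality on the vectors [rigid e w] gives the Legendre transform M = A^-1 w_v, with
    w_v the angular velocity of [v]; then M.(A M) = w_v.(A^-1 w_v). *)
Lemma rigid_metric_kinetic (A : 'M[R]_3) (H : phase R -> R) :
  A^T = A -> A \in unitmx ->
  (forall z, H z = 2^-1 * dot (A *m mom z.1 z.2) (mom z.1 z.2)) ->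
  kinetic_hamiltonian (rigid_metric (invmx A)) H.
Proof.
move=> AT uA HE e p v /cotangentP[/= se tp] tv h.
have -> : H (e, p) = 2^-1 * dot (A *m mom e p) (mom e p) by rewrite HE.
suff -> : mom e p = invmx A *m angvel e v.
  by rewrite mulKVmx.
apply: dot_inj => w; rewrite -pairing_rigid h; last first.
  by apply/tangent_stiefelP/tangent_rigid.
by rewrite /rigid_metric angvel_rigid // dot_trmx trmx_inv AT.
Qed.

End Metric.

Theorem proposition1 (R : realType) (eta b1 b2 b3 b4 b5 b6 : R)
    (Hpos : momenta_posdef (Hb b1 b2 b3 b4 b5 b6)) :
  (exists g : pair3 R -> pair3 R -> pair3 R -> R,
     [/\ riemannian_metric g, SO3_invariant g
       & kinetic_hamiltonian g (Hb b1 b2 b3 b4 b5 b6)]) /\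
  Ab b1 b2 b3 b4 b5 b6 \in unitmx /\
  represents_gyrostat eta (Hb b1 b2 b3 b4 b5 b6)
    (invmx (Ab b1 b2 b3 b4 b5 b6)) (vec3 0%R 0%R (- eta)%R).
Proof.
have AT := trmx_Ab b1 b2 b3 b4 b5 b6; have Apos := Ab_posdef Hpos.
have uA := posdef_unitmx AT Apos; have inA := posdef_invmx AT Apos.
split; [|split=> //; split=> //].
- exists (rigid_metric (invmx (Ab b1 b2 b3 b4 b5 b6))); split.
  + exact: rigid_metric_riemannian.
  + exact: rigid_metric_invariant.
  + by apply: rigid_metric_kinetic => // z; exact: HbE.
- exact: to_body_bij.
- move=> J gamma oJ _ Jgamma; apply: hamiltonian_gyrostat => // z Y.
  exact: derive_Hb.
Qed.
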